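(* Let $\Delta t>0$ and let $(f^n,r^n)_{n\ge0}$ be produced by the scheme SAV-1st-P-B for the Boltzmann collision operator $Q_B$: $r^0=\sqrt{H^0}$ and, for all $n\ge 0$, $$\frac{f^{n+1}-f^n}{\Delta t}=\frac{r^{n+1}}{\sqrt{H^n}}\,Q_B(f^n)+\beta f^n-\beta f^{n+1},\qquad \frac{r^{n+1}-r^n}{\Delta t}=\frac{1}{2\sqrt{H^n}}\int_\Omega\log f^n\,\frac{f^{n+1}-f^n}{\Delta t}\,dv,$$ where $H^n=H(f^n)=\int_\Omega f^n\log f^n\,dv+C\ge H_{\min}>0$ and the stabilizing constant $\beta$ satisfies $\beta\ge\frac{r^0}{\sqrt{H_{\min}}}\max Q_B^-(f)\ge 0$. Then for all $n\ge 0$ (and every step size $\Delta t>0$): (1) $f^n\ge 0$, provided initially $f^0\ge 0$; (2) (conservation of mass, momentum and energy) $\displaystyle\int_\Omega f^{n+1}(1,v,|v|^2)^T\,dv=\int_\Omega f^n(1,v,|v|^2)^T\,dv$; (3) (modified entropy dissipation) with $\tilde H^n=(r^n)^2$, $$\tilde H^{n+1}-\tilde H^n=-(r^{n+1}-r^n)^2+\frac{\Delta t\,(r^{n+1})^2}{(1+\beta\Delta t)H^n}\int_\Omega Q_B(f^n)\log f^n\,dv\le 0.$$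
   Context: The scheme is a time discretization of the spatially homogeneous Boltzmann equation $\partial_t f=Q_B(f)$, $f=f(t,v)$. The Boltzmann collision operator is $$Q_B(f)(v)=\int_{\mathbb{R}^d}\int_{S^{d-1}}B(v-v_*,\sigma)[f(v')f(v_*')-f(v)f(v_* )]\,d\sigma\,dv_*,$$ with $d\ge2$, $v'=\frac{v+v_*}{2}+\frac{|v-v_*|}{2}\sigma$, $v_*'=\frac{v+v_*}{2}-\frac{|v-v_*|}{2}\sigma$, and nonnegative collision kernel $B(v-v_*,\sigma)=C_B|v-v_*|^\gamma b(\cos\theta)$, $\cos\theta=\frac{\sigma\cdot(v-v_* )}{|v-v_*|}$, $-d<\gamma\le1$. It splits into gain and loss parts, $Q_B(f)=Q_B^+(f)-Q_B^-(f)f$, with $$Q_B^+(f)(v)=\int_{\mathbb{R}^d}\int_{S^{d-1}}B(v-v_*,\sigma)f(v')f(v_*')\,d\sigma\,dv_*,\qquad Q_B^-(f)(v)=\int_{\mathbb{R}^d}\int_{S^{d-1}}B(v-v_*,\sigma)f(v_* )\,d\sigma\,dv_*,$$ and $Q_B^\pm(f)\ge0$ when $f\ge0$. In the scheme the velocity variable is kept continuous but ranges over a bounded (truncated) domain $\Omega\subset\mathbb{R}^d$, and $Q_B$ denotes the correspondingly truncated/discretized operator acting on functions on $\Omega$. It is assumed that this operator retains the splitting $Q_B(f)=Q_B^+(f)-Q_B^-(f)f$ with $Q_B^\pm(f)\ge0$ for $f\ge0$, and that for every nonnegative $f$ to which it is applied: - $\int_\Omega Q_B(f)\,dv=0$,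 $\int_\Omega Q_B(f)\,v\,dv=0$, $\int_\Omega Q_B(f)\,|v|^2\,dv=0$; - (H-theorem) $\int_\Omega Q_B(f)\log f\,dv\le0$. The real constant $C$ is chosen so that $H(f)=\int_\Omega f\log f\,dv+C$ is bounded below by a constant $H_{\min}>0$ along the evolution. In the condition on $\beta$, $\max Q_B^-(f)$ means an upper bound for $Q_B^-(f^n)(v)$ over all $v\in\Omega$ and all iterates $f^n$, i.e. $\beta\ge\frac{r^0}{\sqrt{H_{\min}}}Q_B^-(f^n)(v)$ for all $n\ge 0$, $v\in\Omega$. The initial datum $f^0$ is a nonnegative function (a probability density type function). Conventions: $\log 0=-\infty$ and $0\cdot(-\infty)=0$; it is a standing assumption that whenever $f^n\ge0$ all integrals appearing in step $n$ of the scheme are well defined and finite. *)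

(* Defs.v *)
From HB Require Import structures.
From mathcomp Require Import all_boot all_order all_algebra.
From mathcomp Require Import all_classical all_reals all_analysis.

Set Implicit Arguments.
Unset Strict Implicit.
Unset Printing Implicit Defensive.

Import Order.TTheory GRing.Theory Num.Theory.
Import numFieldNormedType.Exports.

Local Open Scope classical_set_scope.
Local Open Scope ring_scope.

Notation Rn R d := (d.-tuple (measurableTypeR R)).

(* The library has no Lebesgue measure on R^d: it is built by induction on d,
   as the image of lebesgue_measure \x m under (x, v) |-> x :: v. *)
Section lebesgue_cons.
Context (R : realType) (n : nat).
Variable m : {sigma_finite_measure set (Rn R n) -> \bar R}.

Definition cons_pair (p : measurableTypeR R * Rn R n) : Rn R n.+1 :=
  [tuple of p.1 :: p.2].

Lemma measurable_cons_pair : measurable_fun [set: _] cons_pair.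
Proof. exact: measurable_cons. Qed.

Definition lebesgue_cons : set (Rn R n.+1) -> \bar R :=
  pushforward (@lebesgue_measure R \x m)%E cons_pair.

Let lebesgue_cons0 : lebesgue_cons set0 = 0%E.
Proof. by rewrite /lebesgue_cons /pushforward preimage_set0 measure0. Qed.

Let lebesgue_cons_ge0 A : (0 <= lebesgue_cons A)%E.
Proof. by rewrite /lebesgue_cons /pushforward; exact: measure_ge0. Qed.

Let lebesgue_cons_sigma_additive : semi_sigma_additive lebesgue_cons.
Proof.
have mf (A : set (Rn R n.+1)) : measurable A -> measurable (cons_pair @^-1` A).
  by move=> mA; rewrite -[X in measurable X]setTI; exact: measurable_cons_pair.
move=> F mF tF mUF; rewrite /lebesgue_cons /pushforward preimage_bigcup.
apply: measure_semi_sigma_additive => [k||]; first exact: mf.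
- apply/trivIsetP => /= i j _ _ ij; rewrite -preimage_setI.
  by move/trivIsetP : tF => /(_ _ _ _ _ ij) ->//; rewrite preimage_set0.
- by rewrite -preimage_bigcup; exact: mf.
Qed.

HB.instance Definition _ := isMeasure.Build _ _ _ lebesgue_cons
  lebesgue_cons0 lebesgue_cons_ge0 lebesgue_cons_sigma_additive.

Let uncons (v : Rn R n.+1) : measurableTypeR R * Rn R n :=
  (tnth v ord0, [tuple of behead v]).

Let measurable_uncons : measurable_fun [set: _] uncons.
Proof.
apply/measurable_fun_pair; first exact: measurable_tnth.
exact: measurable_behead.
Qed.

Let cons_pairK : cancel cons_pair uncons.
Proof. by case=> x v; rewrite /uncons /cons_pair/=; congr pair; apply: val_inj. Qed.

Let lebesgue_cons_sigma_finite : sigma_finite setT lebesgue_cons.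
Proof.
have /sigma_finiteP[F [TF ndF Foo]] := sigma_finiteT (@lebesgue_measure R).
have /sigma_finiteP[G [TG ndG Goo]] := sigma_finiteT m.
exists (fun k => uncons @^-1` (F k `*` G k)).
  apply/esym; rewrite -subTset => v _.
  have [i _ Fi] : (\bigcup_k F k) (uncons v).1 by rewrite -TF.
  have [j _ Gj] : (\bigcup_k G k) (uncons v).2 by rewrite -TG.
  exists (maxn i j) => //; split.
    by apply: (subsetPset _ _ (ndF _ _ _)) Fi; exact: leq_maxl.
  by apply: (subsetPset _ _ (ndG _ _ _)) Gj; exact: leq_maxr.
move=> k; have [mF Fk] := Foo k; have [mG Gk] := Goo k; split.
  rewrite -[X in measurable X]setTI; apply: measurable_uncons => //.
  exact: measurableX.
rewrite /lebesgue_cons /pushforward -comp_preimage.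
rewrite (_ : uncons \o cons_pair = id); last exact/funext/cons_pairK.
by rewrite product_measure1E// lte_mul_pinfty// ge0_fin_numE.
Qed.

HB.instance Definition _ := Measure_isSigmaFinite.Build _ _ _ lebesgue_cons
  lebesgue_cons_sigma_finite.

End lebesgue_cons.

Fixpoint lebesgue_Rn (R : realType) (d : nat) :
    {sigma_finite_measure set (Rn R d) -> \bar R} :=
  if d is n.+1 then lebesgue_cons (lebesgue_Rn R n) else \d_[tuple].

Lemma lebesgue_Rn_box (R : realType) (d : nat) (A : 'I_d -> set R) :
  (forall i, measurable (A i : set (measurableTypeR R))) ->
  lebesgue_Rn R d [set v | forall i, A i (tnth v i)] =
  (\prod_(i < d) lebesgue_measure (A i))%E.
Proof.
elim: d A => [|d IHd] A mA /=.
  by rewrite big_ord0 diracE mem_set// => -[].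
have mB : measurable [set v : Rn R d | forall i, A (lift ord0 i) (tnth v i)].
  rewrite (_ : [set _ | _] =
      \bigcap_(i in [set: 'I_d]) ((fun v : Rn R d => tnth v i) @^-1` A (lift ord0 i))).
    apply: fin_bigcap_measurable => // i _.
    by rewrite -[X in measurable X]setTI; exact: measurable_tnth.
  by apply/seteqP; split => v /= h i; [move=> _|]; exact: h.
rewrite /lebesgue_cons /pushforward big_ord_recl.
rewrite -(IHd (fun i => A (lift ord0 i)))//.
set B := [set v : Rn R d | _] in mB *.
rewrite (_ : _ @^-1` _ = (A ord0 : set (measurableTypeR R)) `*` B).
  exact: product_measure1E.
apply/seteqP; split => -[x v] /=.
  move=> h; split; first exact: (h ord0).
  by move=> i; have := h (lift ord0 i); rewrite tnthS/=.
move=> [Ax Av] i; case: (unliftP ord0 i) => [j ->|->//].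
by rewrite tnthS; exact: Av.
Qed.

Section sav_boltzmann.
Context (R : realType) (d : nat).
Implicit Types (Omega : set (Rn R d)) (f g : Rn R d -> R).
Implicit Types (Qp Qm : (Rn R d -> R) -> Rn R d -> R).

Definition dot_self (v : Rn R d) : R := \sum_(i < d) tnth v i ^+ 2.

Definition bounded_domain Omega : Prop :=
  measurable Omega /\ exists M : R, forall v, Omega v -> dot_self v <= M.

Definition nonneg_on Omega f : Prop := forall v, Omega v -> 0 <= f v.

(* The entries of (1, v, |v|^2), the momentum being taken componentwise. *)
Definition invariants : set (Rn R d -> R) :=
  [set phi | [\/ phi = (fun=> 1), exists i, phi = (fun v => tnth v i)
               | phi = dot_self]].

Definition collision Qp Qm f (v : Rn R d) : R := Qp f v - Qm f v * f v.

(* lne is used instead of ln because lne 0 = -oo while ln 0 = 0; products are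
   taken in \bar R, where 0 * -oo = 0. *)
Definition logf f (v : Rn R d) : \bar R := lne (f v)%:E.

Definition integral_on Omega (F : Rn R d -> \bar R) : \bar R :=
  (\int[lebesgue_Rn R d]_(v in Omega) F v)%E.

Definition finite_integral Omega (F : Rn R d -> \bar R) : Prop :=
  (lebesgue_Rn R d).-integrable Omega F.

Definition entropy Omega (C : R) f : R :=
  fine (integral_on Omega (fun v => (f v)%:E * logf f v)%E) + C.

(* dom is the class of functions to which the truncated operator is applied. *)
Record truncated_collision Omega (dom : set (Rn R d -> R)) Qp Qm : Prop := {
  gain_ge0 : forall f, dom f -> nonneg_on Omega f -> nonneg_on Omega (Qp f);
  loss_ge0 : forall f, dom f -> nonneg_on Omega f -> nonneg_on Omega (Qm f);
  collision_invariants : forall f phi, dom f -> nonneg_on Omega f ->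
    invariants phi ->
    integral_on Omega (fun v => (collision Qp Qm f v * phi v)%:E) = 0%E;
  H_theorem : forall f, dom f -> nonneg_on Omega f ->
    (integral_on Omega (fun v => (collision Qp Qm f v)%:E * logf f v) <= 0)%E
}.

Record SAV_1st_P_B Omega Qp Qm (C beta dt : R)
    (f : nat -> Rn R d -> R) (r : nat -> R) : Prop := {
  sav_init : r 0%N = Num.sqrt (entropy Omega C (f 0%N));
  sav_density : forall n v, Omega v ->
    (f n.+1 v - f n v) / dt =
    r n.+1 / Num.sqrt (entropy Omega C (f n)) * collision Qp Qm (f n) v
      + beta * f n v - beta * f n.+1 v;
  sav_scalar : forall n,
    (((r n.+1 - r n) / dt)%:E =
     ((2 * Num.sqrt (entropy Omega C (f n)))^-1)%:E *
     integral_on Omega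
       (fun v => logf (f n) v * ((f n.+1 v - f n v) / dt)%:E))%E
}.

(* g is the iterate following f. *)
Record step_integrals_finite Omega Qp Qm (dt : R) f g : Prop := {
  finite_moments : forall phi, invariants phi ->
    finite_integral Omega (fun v => (f v * phi v)%:E);
  finite_collision_moments : forall phi, invariants phi ->
    finite_integral Omega (fun v => (collision Qp Qm f v * phi v)%:E);
  finite_entropy :
    finite_integral Omega (fun v => (f v)%:E * logf f v)%E;
  finite_entropy_production :
    finite_integral Omega (fun v => (collision Qp Qm f v)%:E * logf f v)%E;
  finite_entropy_increment :
    finite_integral Omega (fun v => logf f v * ((g v - f v) / dt)%:E)%E
}.

End sav_boltzmann.

Definition modified_entropy (R : realType) (r : nat -> R) (n : nat) : R :=
  r n ^+ 2.

(* Main.v *)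
Require Import Defs.
From mathcomp Require Import all_boot all_order all_algebra.
From mathcomp Require Import all_classical all_reals all_analysis.
From mathcomp Require Import ring lra.

(** The scheme treats the loss term implicitly only through the relaxation
    [beta * f - beta * f'], so one step is explicit up to a factor:
      [f' - f = kappa * Q(f)], where [kappa = dt / (1 + beta * dt) * r' / sqrt H].
    Every conclusion follows from this identity.

    Integrated against a collision invariant it gives conservation.
    Substituted in the scalar equation it gives
      [r' - r = r' * s], where
      [s = dt / (2 * (1 + beta * dt) * H) * \int Q(f) log f <= 0]
    by the H-theorem.  Hence [r' = r / (1 - s)] lies between [0] and [r]
    whatever the step size, and multiplying by [2 * r'] yields the entropy
    balance.

    Positivity of the density and the bounds [0 <= r n <= r 0] are proved by a
    single induction, since each needs the other.  The H-theorem is available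
    only for a nonnegative density, and is what makes [r'] nonnegative and at
    most [r 0].  Conversely [0 <= r' <= r 0] and [Hmin <= H] bound the actual reaction rate
    [r' / sqrt H * Q^-(f)] by [beta], and then
      [(1 + beta * dt) * f'
         = f + dt * (r' / sqrt H * Q^+(f) + (beta - r' / sqrt H * Q^-(f)) * f)]
    is a sum of nonnegative terms. *)

Set Implicit Arguments.
Unset Strict Implicit.
Unset Printing Implicit Defensive.

Import Order.TTheory GRing.Theory Num.Theory.
Import numFieldNormedType.Exports.

Local Open Scope classical_set_scope.
Local Open Scope ring_scope.

(** * One step of the scheme at a fixed velocity *)

Lemma relaxation_factor_gt0 (R : realFieldType) (beta dt : R) :
  0 <= beta -> 0 < dt -> 0 < 1 + beta * dt.
Proof. by move=> beta0 dt0; rewrite ltr_wpDr// mulr_ge0// ltW. Qed.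

Lemma stabilized_step_increment (R : realFieldType) (beta dt a q x y : R) :
  0 <= beta -> 0 < dt -> (y - x) / dt = a * q + beta * x - beta * y ->
  y - x = dt / (1 + beta * dt) * a * q.
Proof.
move=> beta0 dt0 eqxy.
have den0 : 1 + beta * dt != 0 by rewrite gt_eqF// relaxation_factor_gt0.
have {}eqxy : y - x = dt * (a * q + beta * x - beta * y).
  by rewrite -eqxy mulrC divfK// gt_eqF.
have -> : dt / (1 + beta * dt) * a * q = dt * a * q / (1 + beta * dt).
  by field.
by apply: (mulIf den0); rewrite divfK//; lra.
Qed.

(** The relaxation rate [beta] dominates the actual loss rate [a * qm], so that
    the explicit loss term never takes away more than is stored in
    [beta * x]. *)
Lemma stabilized_step_ge0 (R : realFieldType) (beta dt a qp qm x y : R) :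
  0 <= beta -> 0 < dt -> 0 <= a -> 0 <= qp -> a * qm <= beta -> 0 <= x ->
  (y - x) / dt = a * (qp - qm * x) + beta * x - beta * y -> 0 <= y.
Proof.
move=> beta0 dt0 a0 qp0 le_beta x0 eqxy.
have den0 := relaxation_factor_gt0 beta0 dt0.
have {}eqxy : y - x = dt * (a * (qp - qm * x) + beta * x - beta * y).
  by rewrite -eqxy mulrC divfK// gt_eqF.
rewrite -(pmulr_lge0 _ den0).
have -> : y * (1 + beta * dt) = x + dt * (a * qp + (beta - a * qm) * x).
  by lra.
apply: addr_ge0 => //; apply: mulr_ge0; first exact: ltW.
by rewrite addr_ge0// mulr_ge0// subr_ge0.
Qed.

(** The new value [y] is on both sides, so [y = x / (1 - s)]: the denominator is
    at least [1] however negative [s] is, hence no restriction on the step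
    size. *)
Lemma implicit_decay_bounds (R : realFieldType) (s x y : R) :
  s <= 0 -> 0 <= x -> y - x = y * s -> 0 <= y <= x.
Proof.
move=> s0 x0 eqxy; have y0 : 0 <= y.
  have s1 : 0 < 1 - s by rewrite subr_gt0 (le_lt_trans s0).
  by rewrite -(pmulr_lge0 _ s1) (_ : y * _ = x)//; lra.
by rewrite y0 -subr_le0 eqxy mulr_ge0_le0.
Qed.

(** * Moments and entropy along the collision operator *)

Section step.
Context (R : realType) (d : nat) (Omega : set (Rn R d)).
Context (dom : set (Rn R d -> R)) (Qp Qm : (Rn R d -> R) -> Rn R d -> R).

Definition production (g : Rn R d -> R) : R :=
  fine (integral_on Omega (fun v => (collision Qp Qm g v)%:E * logf g v)%E).

Lemma production_fin (dt : R) (f g : Rn R d -> R) :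
  measurable Omega -> step_integrals_finite Omega Qp Qm dt f g ->
  integral_on Omega (fun v => (collision Qp Qm f v)%:E * logf f v)%E =
  (production f)%:E.
Proof.
move=> mO [_ _ _ fin_prod _].
by rewrite fineK//; exact: integrable_fin_num.
Qed.

Lemma production_le0 (g : Rn R d -> R) :
  truncated_collision Omega dom Qp Qm -> dom g -> nonneg_on Omega g ->
  production g <= 0.
Proof. by move=> hQ domg g0; apply: fine_le0; exact: (H_theorem hQ). Qed.

(** The moments of the collision operator vanish, so a step along any multiple
    of it conserves them, whatever the auxiliary variable is. *)
Lemma moment_conservation (kappa dt : R) (f g phi : Rn R d -> R) :
  measurable Omega -> truncated_collision Omega dom Qp Qm ->
  dom f -> nonneg_on Omega f ->
  step_integrals_finite Omega Qp Qm dt f g ->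
  (forall v, Omega v -> g v - f v = kappa * collision Qp Qm f v) ->
  invariants phi ->
  integral_on Omega (fun v => (g v * phi v)%:E) =
  integral_on Omega (fun v => (f v * phi v)%:E).
Proof.
move=> mO hQ domf f0 fin gE inv_phi.
have int_f := finite_moments fin inv_phi.
have int_Q := finite_collision_moments fin inv_phi.
transitivity (integral_on Omega (fun v =>
    (f v * phi v)%:E + kappa%:E * (collision Qp Qm f v * phi v)%:E)%E).
  apply: eq_integral => v /set_mem Ov.
  rewrite -EFinM -EFinD; congr EFin.
  by rewrite mulrA -mulrDl -(gE v Ov) addrC subrK.
rewrite /integral_on integralD//=; last exact: integrableZl.
rewrite integralZl//.
have /= := collision_invariants hQ domf f0 inv_phi.
by rewrite /integral_on => ->; rewrite mule0 adde0.
Qed.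

(** The scalar [kappa] is pulled out in the extended reals, where [logf f] may
    be [-oo] on the zero set of [f]; this rests on the associativity of the
    product there and on the integrability of the entropy production. *)
Lemma entropy_increment (kappa dt : R) (f g : Rn R d -> R) :
  measurable Omega -> step_integrals_finite Omega Qp Qm dt f g ->
  (forall v, Omega v -> g v - f v = kappa * collision Qp Qm f v) ->
  integral_on Omega (fun v => logf f v * ((g v - f v) / dt)%:E)%E =
  (kappa / dt * production f)%:E.
Proof.
move=> mO fin gE; rewrite EFinM -(production_fin mO fin).
rewrite /integral_on -integralZl//; last exact: finite_entropy_production fin.
apply: eq_integral => v /set_mem Ov.
by rewrite gE// mulrAC EFinM muleC muleA.
Qed.

End step.

(** * Positivity and boundedness of the iterates *)

Section scheme.
Context (R : realType) (d : nat) (Omega : set (Rn R d)).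
Context (dom : set (Rn R d -> R)) (Qp Qm : (Rn R d -> R) -> Rn R d -> R).
Context (C Hmin beta dt : R) (f : nat -> Rn R d -> R) (r : nat -> R).

(** The increment of the auxiliary variable relative to its new value, as
    [sav_scalar_increment] shows; it is nonpositive by the H-theorem, hence the
    name. *)
Definition decay_rate (n : nat) : R :=
  dt / (2 * (1 + beta * dt) * entropy Omega C (f n)) *
  production Omega Qp Qm (f n).

Lemma sav_density_increment (n : nat) (v : Rn R d) :
  SAV_1st_P_B Omega Qp Qm C beta dt f r -> 0 <= beta -> 0 < dt -> Omega v ->
  f n.+1 v - f n v =
  dt / (1 + beta * dt) * (r n.+1 / Num.sqrt (entropy Omega C (f n))) *
  collision Qp Qm (f n) v.
Proof.
move=> hscheme beta0 dt0 Ov.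
exact: stabilized_step_increment (sav_density hscheme n Ov).
Qed.

Lemma sav_scalar_increment (n : nat) :
  measurable Omega -> SAV_1st_P_B Omega Qp Qm C beta dt f r ->
  0 <= beta -> 0 < dt -> 0 < entropy Omega C (f n) ->
  step_integrals_finite Omega Qp Qm dt (f n) (f n.+1) ->
  r n.+1 - r n = r n.+1 * decay_rate n.
Proof.
move=> mO hscheme beta0 dt0 H0 fin.
have dt_neq0 : dt != 0 by rewrite gt_eqF.
have den0 : 1 + beta * dt != 0 by rewrite gt_eqF// relaxation_factor_gt0.
have gE := @sav_density_increment n _ hscheme beta0 dt0.
have := sav_scalar hscheme n; rewrite (entropy_increment mO fin gE) -EFinM.
move=> -[/(congr1 ( *%R^~ dt))]; rewrite divfK// => ->.
(* Everything is expressed with [sqrt H], so that [field] can see that the two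
   factors [1 / sqrt H] of the scheme give the [1 / H] of the decay rate. *)
rewrite /decay_rate -{3}(sqr_sqrtr (ltW H0)).
have sqrtH0 : Num.sqrt (entropy Omega C (f n)) != 0 by rewrite gt_eqF// sqrtr_gt0.
by field; rewrite den0 sqrtH0 dt_neq0.
Qed.

Lemma decay_rate_le0 (n : nat) :
  truncated_collision Omega dom Qp Qm -> dom (f n) -> nonneg_on Omega (f n) ->
  0 <= beta -> 0 < dt -> 0 < entropy Omega C (f n) -> decay_rate n <= 0.
Proof.
move=> hQ domf f0 beta0 dt0 H0.
apply: mulr_ge0_le0; last exact: production_le0 hQ domf f0.
have den0 := ltW (relaxation_factor_gt0 beta0 dt0).
by rewrite divr_ge0 ?mulr_ge0// ltW.
Qed.

(** The bounds on [r n.+1] come from the H-theorem at a nonnegative [f n], and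
    they in turn keep the loss rate of the step below [beta], so neither half
    can be proved alone. *)
Lemma sav_invariant :
  measurable Omega -> truncated_collision Omega dom Qp Qm ->
  0 < dt -> (forall n, dom (f n)) ->
  SAV_1st_P_B Omega Qp Qm C beta dt f r ->
  0 < Hmin -> (forall n, Hmin <= entropy Omega C (f n)) -> 0 <= beta ->
  (forall n v, Omega v -> r 0%N / Num.sqrt Hmin * Qm (f n) v <= beta) ->
  (forall n, nonneg_on Omega (f n) ->
     step_integrals_finite Omega Qp Qm dt (f n) (f n.+1)) ->
  nonneg_on Omega (f 0%N) ->
  forall n, nonneg_on Omega (f n) /\ 0 <= r n <= r 0%N.
Proof.
move=> mO hQ dt0 hdom hscheme Hmin0 leH beta0 hbeta hfin f0.
elim=> [|n [fn0 /andP[rn0 rn_le]]].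
  by split=> //; rewrite lexx andbT (sav_init hscheme) sqrtr_ge0.
have Hn0 : 0 < entropy Omega C (f n) := lt_le_trans Hmin0 (leH n).
have /andP[rS0 rS_le] : 0 <= r n.+1 <= r n.
  apply: implicit_decay_bounds rn0 (sav_scalar_increment _ _ _ _ _ (hfin n fn0)) => //.
  exact: decay_rate_le0.
have rS_le0 : r n.+1 <= r 0%N := le_trans rS_le rn_le.
split; last by rewrite rS0.
move=> v Ov; apply: stabilized_step_ge0 (sav_density hscheme n Ov) => //.
- by rewrite divr_ge0// sqrtr_ge0.
- exact: (gain_ge0 hQ).
- apply: le_trans (hbeta n v Ov); apply: ler_wpM2r; first exact: (loss_ge0 hQ).
  by rewrite ler_pM ?invr_ge0 ?sqrtr_ge0// lef_pV2 ?posrE ?sqrtr_gt0// ler_wsqrtr.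
- exact: fn0.
Qed.

End scheme.

(** * Structure preservation *)

Theorem theorem3p1 (R : realType) (d : nat) (hd : (2 <= d)%N)
    (Omega : set (Rn R d)) (hOmega : bounded_domain Omega)
    (dom : set (Rn R d -> R)) (Qp Qm : (Rn R d -> R) -> Rn R d -> R)
    (hQ : truncated_collision Omega dom Qp Qm)
    (C Hmin beta dt : R) (hdt : 0 < dt)
    (f : nat -> Rn R d -> R) (r : nat -> R)
    (hdom : forall n, dom (f n))
    (hscheme : SAV_1st_P_B Omega Qp Qm C beta dt f r)
    (hHmin : 0 < Hmin) (hH : forall n, Hmin <= entropy Omega C (f n))
    (hbeta0 : 0 <= beta)
    (hbeta : forall n v, Omega v -> r 0%N / Num.sqrt Hmin * Qm (f n) v <= beta)
    (hfin : forall n, nonneg_on Omega (f n) ->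
       step_integrals_finite Omega Qp Qm dt (f n) (f n.+1))
    (hf0 : nonneg_on Omega (f 0%N)) (n : nat) :
  [/\ nonneg_on Omega (f n),
      forall phi, invariants phi ->
        integral_on Omega (fun v => (f n.+1 v * phi v)%:E) =
        integral_on Omega (fun v => (f n v * phi v)%:E),
      (modified_entropy r n.+1 - modified_entropy r n)%:E =
      ((- (r n.+1 - r n) ^+ 2)%:E +
       (dt * r n.+1 ^+ 2 / ((1 + beta * dt) * entropy Omega C (f n)))%:E *
       integral_on Omega
         (fun v => (collision Qp Qm (f n) v)%:E * logf (f n) v))%E &
      modified_entropy r n.+1 - modified_entropy r n <= 0].
Proof.
have mO := hOmega.1.
have [fn0 _] := sav_invariant mO hQ hdt hdom hscheme hHmin hH hbeta0 hbeta hfin hf0 n.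
have Hn0 : 0 < entropy Omega C (f n) := lt_le_trans hHmin (hH n).
have rE := sav_scalar_increment mO hscheme hbeta0 hdt Hn0 (hfin n fn0).
set s := decay_rate _ _ _ _ _ _ _ _ in rE.
have s0 : s <= 0 by exact: (decay_rate_le0 hQ).
have balance : modified_entropy r n.+1 - modified_entropy r n =
    - (r n.+1 - r n) ^+ 2 + 2 * r n.+1 ^+ 2 * s.
  have -> : 2 * r n.+1 ^+ 2 * s = 2 * r n.+1 * (r n.+1 * s) by ring.
  by rewrite -rE /modified_entropy; ring.
split=> //.
- move=> phi inv_phi.
  apply: (moment_conservation mO hQ (hdom n) fn0 (hfin n fn0)) inv_phi.
  by move=> v Ov; exact: sav_density_increment hscheme hbeta0 hdt Ov.
- rewrite (production_fin mO (hfin n fn0)) -EFinM -EFinD balance.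
  have den0 : 1 + beta * dt != 0 by rewrite gt_eqF// relaxation_factor_gt0.
  congr (_ + _)%:E; rewrite /s /decay_rate; field.
  by rewrite den0 gt_eqF.
- rewrite balance; have := sqr_ge0 (r n.+1 - r n).
  have : 2 * r n.+1 ^+ 2 * s <= 0 by rewrite mulr_ge0_le0// mulr_ge0// sqr_ge0.
  lra.
Qed.
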